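(* Let $f$ be a smooth real function and let $R_2(u,v)=(u\sinh v,\,u\cosh v,\,f(u))$ be the rotational surface with time-like meridians in the pseudo-isotropic space $\mathbb{I}_p^3$. The time-like loxodromes on $R_2$ (with constant pseudo-isotropic angle $\varphi$ to the meridians) are $$\gamma_4(t)=\bigl(-t\cosh\varphi\,\sinh(\pm\tanh\varphi\,\ln|t|),\ -t\cosh\varphi\,\cosh(\pm\tanh\varphi\,\ln|t|),\ f(-t\cosh\varphi)\bigr),$$ where $\varphi\in\mathbb{R}^+\cup\{0\}$.
   Context: Pseudo-isotropic space $\mathbb{I}_p^3$ is $\mathbb{R}^3$ with coordinates $(x,y,z)$ and the pseudo-isotropic scalar product, for $p=(p_1,p_2,p_3)$ and $q=(q_1,q_2,q_3)$: $\langle p,q\rangle=p_3q_3$ if $p_1=p_2=0$ and $q_1=q_2=0$, and $\langle p,q\rangle=p_1q_1-p_2q_2$ otherwise. A vector $(0,0,p_3)$ is called isotropic; other vectors are non-isotropic. A non-isotropic vector $p$ is space-like if $\langle p,p\rangle>0$ (the zero vector is also counted as space-like), time-like if $\langle p,p\rangle<0$, light-like if $\langle p,p\rangle=0$ and $p\neq0$; a curve is space-like (time-like) if its velocity vectors are. Put $\|p\|=\sqrt{|\langle p,p\rangle|}$. The surface $R_2$ is obtained by applying the hyperbolic rotations $(x,y,z)\mapsto(x\cosh v+y\sinh v,\ x\sinh v+y\cosh v,\ z)$, $v\in\mathbb{R}$, to the time-like profile curve $\alpha_2(u)=(0,u,f(u))$. Its induced metric is $ds^2=-du^2+u^2dv^2$.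 Its meridians are the curves $\beta_v(u)=R_2(u,v)$ with $v$ constant; they are time-like. For time-like non-isotropic vectors $p,q$ with the same parity (i.e. the same time-orientation: $p_2$ and $q_2$ have the same sign), the pseudo-isotropic angle $\varphi\in\mathbb{R}^+\cup\{0\}$ between $p$ and $q$ is given by $\langle p,q\rangle=\|p\|\,\|q\|\cosh\varphi$. A loxodrome is a curve on the rotational surface which cuts all meridians at a constant angle, i.e. the angle between its velocity vector at each of its points and the meridian's tangent vector $\beta_v'$ at that point is constant. In the formula, the curve is $\gamma_4(t)=R_2(u(t),v(t))$ with $u(t)=-t\cosh\varphi$ and $v(t)=\pm\tanh\varphi\,\ln|t|$, the sign of $v$ being the same in both components where it occurs.
   Formalization: The same-parity condition in the angle is dropped, as it contradicts <p,q> = ||p|| ||q|| cosh φ for time-like vectors; and loxodromes are shown to be γ_4 only up to a hyperbolic rotation and an arc-length reparametrization, since rotated or shifted γ_4 are loxodromes too. *)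

(* Defs.v *)
From Stdlib Require Import Reals Lra.
From Coquelicot Require Import Coquelicot.
Open Scope R_scope.

(** * Pseudo-isotropic space *)

Record point := Pt { px : R; py : R; pz : R }.

Definition isotropic (p : point) : Prop := px p = 0 /\ py p = 0.

Definition isotropic_dec (p : point) : {isotropic p} + {~ isotropic p}.
Proof.
  unfold isotropic.
  destruct (Req_EM_T (px p) 0); destruct (Req_EM_T (py p) 0); tauto.
Defined.

Definition pi_dot (p q : point) : R :=
  match isotropic_dec p, isotropic_dec q with
  | left _, left _ => pz p * pz q
  | _, _ => px p * px q - py p * py q
  end.

Definition pi_norm (p : point) : R := sqrt (Rabs (pi_dot p p)).

Definition time_like (p : point) : Prop := ~ isotropic p /\ pi_dot p p < 0.

(** The angle between time-like vectors is defined by the equation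
    <p,q> = |p| |q| cosh phi, phi >= 0.  For time-like p, q this equation can
    hold only if the second coordinates of p and q have opposite signs, since
    <p,q> < 0 when those signs agree; hence no condition on the time
    orientations is added to it. *)
Definition pi_angle (p q : point) (phi : R) : Prop :=
  time_like p /\ time_like q /\ 0 <= phi /\
  pi_dot p q = pi_norm p * pi_norm q * cosh phi.

(** * Curves *)

Definition in_interval (a b : Rbar) (t : R) : Prop := Rbar_lt a t /\ Rbar_lt t b.

Definition smooth (g : R -> R) : Prop := forall n t, ex_derive_n g n t.

Definition smooth_on (a b : Rbar) (g : R -> R) : Prop :=
  forall n t, in_interval a b t -> ex_derive_n g n t.

Definition velocity (c : R -> point) (t : R) : point :=
  Pt (Derive (fun s => px (c s)) t)
     (Derive (fun s => py (c s)) t)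
     (Derive (fun s => pz (c s)) t).

Definition time_like_curve (a b : Rbar) (c : R -> point) : Prop :=
  forall t, in_interval a b t -> time_like (velocity c t).

(** * The rotational surface and its loxodromes *)

Definition hyp_rot (v : R) (p : point) : point :=
  Pt (px p * cosh v + py p * sinh v) (px p * sinh v + py p * cosh v) (pz p).

Definition R2 (f : R -> R) (u v : R) : point :=
  Pt (u * sinh v) (u * cosh v) (f u).

Definition meridian (f : R -> R) (v : R) : R -> point := fun u => R2 f u v.

(** A curve on the surface is given by smooth surface parameters u, v on the
    open interval (a,b), whose ends may be infinite. *)
Definition loxodrome (f : R -> R) (phi : R) (a b : Rbar) (c : R -> point) : Prop :=
  exists u v : R -> R,
    smooth_on a b u /\ smooth_on a b v /\
    forall t, in_interval a b t ->
      c t = R2 f (u t) (v t) /\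
      pi_angle (velocity c t) (velocity (meridian f (v t)) (u t)) phi.

Definition time_like_loxodrome (f : R -> R) (phi : R) (a b : Rbar)
    (c : R -> point) : Prop :=
  time_like_curve a b c /\ loxodrome f phi a b c.

(** [e] stands for the sign +1 or -1. *)
Definition gamma4 (f : R -> R) (phi e t : R) : point :=
  Pt (- t * cosh phi * sinh (e * tanh phi * ln (Rabs t)))
     (- t * cosh phi * cosh (e * tanh phi * ln (Rabs t)))
     (f (- t * cosh phi)).

(* Main.v *)
Require Import Defs.
From Stdlib Require Import Reals Lra Classical.
From Coquelicot Require Import Coquelicot.
Open Scope R_scope.

(** In the moving frame of the meridian the velocity of [R2 f (u t) (v t)] has
    components [u'] and [u v'], so the angle condition reads
    [- u' = sqrt (u'^2 - (u v')^2) * cosh phi], that is, [u' < 0] and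
    [(u v')^2 = (tanh phi * u')^2].  By connectedness [u v' = e tanh phi u'] with a
    constant sign [e]; integrating [v' = e tanh phi u' / u] with
    [tau = - u / cosh phi] gives [v = v0 + e tanh phi ln |tau|]. *)

(** * Hyperbolic functions *)

Lemma cosh2_minus_sinh2 (x : R) : cosh x ^ 2 - sinh x ^ 2 = 1.
Proof.
  unfold cosh, sinh. rewrite exp_Ropp. field. apply Rgt_not_eq, exp_pos.
Qed.

Lemma cosh_pos (x : R) : 0 < cosh x.
Proof. unfold cosh. pose proof (exp_pos x). pose proof (exp_pos (- x)). lra. Qed.

Lemma sinh_plus (x y : R) : sinh (x + y) = sinh x * cosh y + cosh x * sinh y.
Proof.
  unfold cosh, sinh. rewrite Ropp_plus_distr, !exp_plus. field.
Qed.

Lemma cosh_plus (x y : R) : cosh (x + y) = cosh x * cosh y + sinh x * sinh y.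
Proof.
  unfold cosh, sinh. rewrite Ropp_plus_distr, !exp_plus. field.
Qed.

Lemma cosh_tanh (x : R) : cosh x * tanh x = sinh x.
Proof. unfold tanh. field. apply Rgt_not_eq, cosh_pos. Qed.

Lemma tanh_pos (x : R) : 0 < x -> 0 < tanh x.
Proof.
  intros Hx. unfold tanh. apply Rdiv_lt_0_compat; [| apply cosh_pos].
  rewrite <- sinh_0. now apply sinh_lt.
Qed.

(** * Functions on an interval *)

Lemma in_interval_locally (a b : Rbar) (t : R) :
  in_interval a b t -> locally t (in_interval a b).
Proof.
  intros [Ha Hb].
  apply filter_and; [now apply open_Rbar_gt | now apply open_Rbar_lt].
Qed.

Lemma in_interval_between (a b : Rbar) (s t r : R) :
  in_interval a b s -> in_interval a b t -> s <= r <= t -> in_interval a b r.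
Proof.
  intros [Has _] [_ Htb] [Hsr Hrt]. split.
  - now apply Rbar_lt_le_trans with s.
  - now apply Rbar_le_lt_trans with t.
Qed.

Lemma constant_of_derive_0 (a b : Rbar) (g : R -> R) :
  (forall t, in_interval a b t -> is_derive g t 0) ->
  exists k, forall t, in_interval a b t -> g t = k.
Proof.
  intros Hg.
  assert (Hlt : forall s t, in_interval a b s -> in_interval a b t -> s < t ->
                            g s = g t).
  { intros s t Hs Ht Hst. apply eq_is_derive with (2 := Hst).
    intros r Hr. apply Hg. now apply in_interval_between with s t. }
  (* Nothing forces [a < b]. On an empty interval any constant serves; otherwise the value at one
     point is taken. *)
  destruct (classic (exists t, in_interval a b t)) as [[s Hs] | Hempty].
  - exists (g s). intros t Ht.
    destruct (Rtotal_order s t) as [Hst | [-> | Hst]].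
    + symmetry. now apply Hlt.
    + reflexivity.
    + now apply Hlt.
  - exists 0. intros t Ht. exfalso. apply Hempty. now exists t.
Qed.

(** Differentiating [h ^ 2 = k ^ 2] gives [h h' = 0]. If [k <> 0], then [h] has no zero, so [h' = 0]
    and [h] is constant; its value at a single point fixes the sign. If [k = 0], either sign will
    do. *)
Lemma constant_sign_of_sqr (a b : Rbar) (h : R -> R) (k : R) :
  (forall t, in_interval a b t -> ex_derive h t) ->
  (forall t, in_interval a b t -> h t ^ 2 = k ^ 2) ->
  exists e, (e = 1 \/ e = -1) /\ forall t, in_interval a b t -> h t = e * k.
Proof.
  intros Hex Hsq.
  destruct (Req_dec k 0) as [-> | Hk].
  { exists 1. split; [now left |]. intros t Ht.
    specialize (Hsq t Ht). nra. }
  destruct (constant_of_derive_0 a b h) as [m Hm].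
  { intros t Ht.
    assert (H0 : Derive (fun s => h s ^ 2) t = 0).
    { rewrite <- (Derive_const (k ^ 2) t). apply Derive_ext_loc.
      apply filter_imp with (2 := in_interval_locally a b t Ht). exact Hsq. }
    rewrite Derive_pow in H0 by now apply Hex. simpl in H0.
    assert (Hh : h t <> 0).
    { intros Hz. specialize (Hsq t Ht). rewrite Hz in Hsq.
      apply Hk. nra. }
    replace 0 with (Derive h t).
    - apply Derive_correct. now apply Hex.
    - apply Rmult_eq_reg_r with (h t); nra. }
  destruct (classic (exists t, in_interval a b t)) as [[s Hs] | Hempty].
  - assert (Hmk : m = k \/ m = - k).
    { specialize (Hsq s Hs). rewrite (Hm s Hs) in Hsq.
      assert (Hp : (m - k) * (m + k) = 0) by (ring_simplify; lra).
      apply Rmult_integral in Hp. lra. }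
    destruct Hmk as [-> | ->].
    + exists 1. split; [now left |]. intros t Ht. rewrite (Hm t Ht). ring.
    + exists (-1). split; [now right |]. intros t Ht. rewrite (Hm t Ht). ring.
  - exists 1. split; [now left |]. intros t Ht. exfalso. apply Hempty. now exists t.
Qed.

Lemma smooth_on_ex_derive (a b : Rbar) (g : R -> R) (t : R) :
  smooth_on a b g -> in_interval a b t -> ex_derive g t.
Proof. intros Hg Ht. exact (Hg 1%nat t Ht). Qed.

Lemma smooth_on_ex_derive_2 (a b : Rbar) (g : R -> R) (t : R) :
  smooth_on a b g -> in_interval a b t -> ex_derive (Derive g) t.
Proof. intros Hg Ht. exact (Hg 2%nat t Ht). Qed.

(* Differentiating [u v' = 0] at a zero of [u] gives [u' v' = 0]. *)
Lemma derive_0_of_mult_derive_0 (a b : Rbar) (u v : R -> R) (t : R) :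
  smooth_on a b u -> smooth_on a b v ->
  (forall s, in_interval a b s -> u s * Derive v s = 0) ->
  in_interval a b t -> Derive u t <> 0 -> Derive v t = 0.
Proof.
  intros Hu Hv H Ht Hdu.
  assert (H0 : Derive (fun s => u s * Derive v s) t = 0).
  { rewrite <- (Derive_const 0 t). apply Derive_ext_loc.
    apply filter_imp with (2 := in_interval_locally a b t Ht). exact H. }
  rewrite Derive_mult in H0;
    [| now apply (smooth_on_ex_derive a b) | now apply (smooth_on_ex_derive_2 a b)].
  destruct (Rmult_integral _ _ (H t Ht)) as [Hut | Hvt]; [| exact Hvt].
  rewrite Hut, Rmult_0_l, Rplus_0_r in H0.
  now destruct (Rmult_integral _ _ H0).
Qed.

(** * The logarithm of [|t|] and its higher derivatives *)

Lemma is_derive_ln_Rabs (t : R) : t <> 0 -> is_derive (fun s => ln (Rabs s)) t (/ t).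
Proof.
  intros Ht. auto_derive.
  - repeat split; [exact Ht | now apply Rabs_pos_lt].
  - destruct (Rdichotomy _ _ Ht) as [Hneg | Hpos].
    + rewrite (sign_eq_m1 t Hneg), (Rabs_left t Hneg). field. lra.
    + rewrite (sign_eq_1 t Hpos), (Rabs_right t) by lra. field. lra.
Qed.

(** Each differentiation of [k / t ^ S n] yields a multiple of the next negative power. The
    constant, in fact [(-1)^n n!], stays existential because only smoothness is wanted. *)
Lemma Derive_n_ln_Rabs (n : nat) :
  exists k, forall t, t <> 0 ->
    is_derive (Derive_n (fun s => ln (Rabs s)) n) t (k / t ^ S n).
Proof.
  induction n as [| n [k IH]].
  - exists 1. intros t Ht. simpl.
    replace (1 / (t * 1)) with (/ t) by now field.
    now apply is_derive_ln_Rabs.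
  - exists (- (k * INR (S n))). intros t Ht.
    apply is_derive_ext_loc with (fun s => k / s ^ S n).
    (* The induction hypothesis gives the derivative only off 0, an open set, so it holds near
       [t]. *)
    + assert (Hloc : locally t (fun s => s <> 0)) by now apply (open_neq 0).
      apply filter_imp with (2 := Hloc). intros s Hs.
      symmetry. apply is_derive_unique, IH, Hs.
    + pose proof (pow_nonzero t n Ht) as Hn.
      auto_derive; [now apply (pow_nonzero t (S n)) |].
      (* [auto_derive] leaves the exponent [INR (S n)] in unfolded form. *)
      change (match n with 0%nat => 1 | S _ => INR n + 1 end) with (INR (S n)).
      rewrite <- !tech_pow_Rmult.
      field. now split.
Qed.

Lemma ex_derive_n_ln_Rabs (n : nat) (t : R) :
  t <> 0 -> ex_derive_n (fun s => ln (Rabs s)) n t.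
Proof.
  intros Ht. destruct n as [| n]; [exact I |].
  destruct (Derive_n_ln_Rabs n) as [k Hk]. eexists. now apply Hk.
Qed.

(** * The angle with the meridians *)

Lemma pi_dot_non_isotropic (p q : point) :
  ~ isotropic p -> pi_dot p q = px p * px q - py p * py q.
Proof.
  intros Hp. unfold pi_dot. now destruct (isotropic_dec p).
Qed.

Lemma pi_norm_pos (p : point) : time_like p -> 0 < pi_norm p.
Proof.
  intros [_ Hp]. apply sqrt_lt_R0, Rabs_pos_lt. lra.
Qed.

Lemma pi_norm_sqr (p : point) : time_like p -> pi_norm p ^ 2 = - pi_dot p p.
Proof.
  intros [_ Hp]. unfold pi_norm. rewrite pow2_sqrt by apply Rabs_pos.
  now apply Rabs_left.
Qed.

Lemma time_like_iff (p : point) : time_like p <-> px p ^ 2 < py p ^ 2.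
Proof.
  split.
  - intros [Hp Hdot]. rewrite pi_dot_non_isotropic in Hdot by exact Hp. nra.
  - intros H. assert (Hp : ~ isotropic p) by (intros [H1 H2]; rewrite H1, H2 in H; lra).
    split; [exact Hp |]. rewrite pi_dot_non_isotropic by exact Hp. nra.
Qed.

Section MeridianFrame.

(* [p] has components [d] along the unit meridian direction [q] and [w] across it. *)
Variables (p q : point) (v d w phi : R).
Hypothesis hpx : px p = d * sinh v + w * cosh v.
Hypothesis hpy : py p = d * cosh v + w * sinh v.
Hypothesis hqx : px q = sinh v.
Hypothesis hqy : py q = cosh v.

Lemma frame_time_like_l : time_like p <-> w ^ 2 < d ^ 2.
Proof using hpx hpy.
  rewrite time_like_iff, hpx, hpy.
  assert (E : (d * cosh v + w * sinh v) ^ 2 - (d * sinh v + w * cosh v) ^ 2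
              = (d ^ 2 - w ^ 2) * (cosh v ^ 2 - sinh v ^ 2)) by ring.
  rewrite cosh2_minus_sinh2 in E. split; intros; lra.
Qed.

Lemma frame_time_like_r : time_like q.
Proof using hqx hqy.
  rewrite time_like_iff, hqx, hqy. pose proof (cosh2_minus_sinh2 v). lra.
Qed.

Lemma frame_norm_l : time_like p -> pi_norm p ^ 2 = d ^ 2 - w ^ 2.
Proof using hpx hpy.
  intros Hp. rewrite pi_norm_sqr by exact Hp.
  rewrite pi_dot_non_isotropic by apply Hp. rewrite hpx, hpy.
  replace (d ^ 2 - w ^ 2) with ((d ^ 2 - w ^ 2) * (cosh v ^ 2 - sinh v ^ 2))
    by (rewrite cosh2_minus_sinh2; ring).
  ring.
Qed.

Lemma frame_norm_r : pi_norm q = 1.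
Proof using hqx hqy.
  pose proof frame_time_like_r as Hq.
  pose proof (pi_norm_pos q Hq) as Hpos.
  pose proof (pi_norm_sqr q Hq) as Hsq.
  rewrite pi_dot_non_isotropic in Hsq by apply Hq. rewrite hqx, hqy in Hsq.
  pose proof (cosh2_minus_sinh2 v). nra.
Qed.

Lemma frame_dot : time_like p -> pi_dot p q = - d.
Proof using hpx hpy hqx hqy.
  intros Hp. rewrite pi_dot_non_isotropic by apply Hp. rewrite hpx, hpy, hqx, hqy.
  replace (- d) with (- d * (cosh v ^ 2 - sinh v ^ 2))
    by (rewrite cosh2_minus_sinh2; ring).
  ring.
Qed.

(** The angle equation becomes [- d = pi_norm p * cosh phi]. This value later shows that [tau] is an
    arc-length parameter. *)
Lemma pi_angle_frame_norm : pi_angle p q phi -> pi_norm p = - d / cosh phi.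
Proof using hpx hpy hqx hqy.
  intros (Hp & _ & _ & Hdot).
  rewrite frame_norm_r, (frame_dot Hp) in Hdot.
  rewrite Hdot. field. apply Rgt_not_eq, cosh_pos.
Qed.

(** Forward, [- d = pi_norm p * cosh phi] forces [d < 0], and [w ^ 2 = d ^ 2 - pi_norm p ^ 2] equals
    [(pi_norm p * sinh phi) ^ 2]. Backward, [(d ^ 2 - w ^ 2) * cosh phi ^ 2 = d ^ 2 > 0] makes [p]
    time-like and gives the squared angle equation. *)
Lemma pi_angle_frame :
  pi_angle p q phi <-> 0 <= phi /\ d < 0 /\ w ^ 2 = (tanh phi * d) ^ 2.
Proof using hpx hpy hqx hqy.
  pose proof (cosh_pos phi) as Hc.
  pose proof (cosh2_minus_sinh2 phi) as Hcs.
  rewrite <- cosh_tanh in Hcs.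
  split.
  - intros Hang. pose proof (pi_angle_frame_norm Hang) as Hnorm.
    destruct Hang as (Hp & _ & Hphi & _).
    pose proof (pi_norm_pos p Hp) as Hpos.
    pose proof (frame_norm_l Hp) as Hsq.
    assert (Hd : - d = pi_norm p * cosh phi) by (rewrite Hnorm; field; lra).
    repeat split; [exact Hphi | nra |].
    replace (w ^ 2) with (d ^ 2 - pi_norm p ^ 2) by lra.
    replace d with (- (pi_norm p * cosh phi)) by lra.
    replace (pi_norm p ^ 2)
      with (pi_norm p ^ 2 * (cosh phi ^ 2 - (cosh phi * tanh phi) ^ 2))
      by (rewrite Hcs; ring).
    ring.
  - intros (Hphi & Hd & Hw).
    assert (Hdw : (d ^ 2 - w ^ 2) * cosh phi ^ 2 = d ^ 2).
    { rewrite Hw. replace (d ^ 2) with (d ^ 2 * 1) at 2 by ring.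
      rewrite <- Hcs. ring. }
    assert (Hp : time_like p).
    { apply frame_time_like_l. nra. }
    repeat split; try apply Hp; try apply frame_time_like_r; [exact Hphi |].
    rewrite frame_norm_r, (frame_dot Hp).
    pose proof (pi_norm_pos p Hp) as Hpos.
    pose proof (frame_norm_l Hp) as Hsq.
    rewrite <- Hsq in Hdw.
    (* Both sides are positive since [d < 0], so it suffices to compare squares. *)
    apply Rsqr_inj; unfold Rsqr; nra.
Qed.

End MeridianFrame.

(** * Velocities of curves on the surface *)

Lemma velocity_ext_loc (c1 c2 : R -> point) (t : R) :
  locally t (fun s => c1 s = c2 s) -> velocity c1 t = velocity c2 t.
Proof.
  intros H. unfold velocity.
  f_equal; apply Derive_ext_loc; apply filter_imp with (2 := H);
    intros s Hs; now rewrite Hs.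
Qed.

(** Together with the second coordinate, this is the frame form required by [pi_angle_frame], with
    [d = u'] and [w = u v']. *)
Lemma velocity_R2_px (f u v : R -> R) (t : R) :
  ex_derive u t -> ex_derive v t ->
  px (velocity (fun s => R2 f (u s) (v s)) t)
  = Derive u t * sinh (v t) + u t * Derive v t * cosh (v t).
Proof.
  intros Hu Hv. simpl. apply is_derive_unique. auto_derive.
  - repeat split; assumption.
  - change (Derive (fun x => u x)) with (Derive u).
    change (Derive (fun x => v x)) with (Derive v). ring.
Qed.

Lemma velocity_R2_py (f u v : R -> R) (t : R) :
  ex_derive u t -> ex_derive v t ->
  py (velocity (fun s => R2 f (u s) (v s)) t)
  = Derive u t * cosh (v t) + u t * Derive v t * sinh (v t).
Proof.
  intros Hu Hv. simpl. apply is_derive_unique. auto_derive.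
  - repeat split; assumption.
  - change (Derive (fun x => u x)) with (Derive u).
    change (Derive (fun x => v x)) with (Derive v). ring.
Qed.

Lemma velocity_meridian_px (f : R -> R) (v u : R) :
  px (velocity (meridian f v) u) = sinh v.
Proof. simpl. apply is_derive_unique. auto_derive; [exact I | ring]. Qed.

Lemma velocity_meridian_py (f : R -> R) (v u : R) :
  py (velocity (meridian f v) u) = cosh v.
Proof. simpl. apply is_derive_unique. auto_derive; [exact I | ring]. Qed.

Lemma pi_angle_R2 (f u v : R -> R) (t phi : R) :
  ex_derive u t -> ex_derive v t ->
  pi_angle (velocity (fun s => R2 f (u s) (v s)) t)
           (velocity (meridian f (v t)) (u t)) phi
  <-> 0 <= phi /\ Derive u t < 0
      /\ (u t * Derive v t) ^ 2 = (tanh phi * Derive u t) ^ 2.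
Proof.
  intros Hu Hv.
  apply pi_angle_frame with (v t);
    [now apply velocity_R2_px | now apply velocity_R2_py
    | apply velocity_meridian_px | apply velocity_meridian_py].
Qed.

Lemma pi_norm_velocity_R2 (f u v : R -> R) (t phi : R) :
  ex_derive u t -> ex_derive v t ->
  pi_angle (velocity (fun s => R2 f (u s) (v s)) t)
           (velocity (meridian f (v t)) (u t)) phi ->
  pi_norm (velocity (fun s => R2 f (u s) (v s)) t) = - Derive u t / cosh phi.
Proof.
  intros Hu Hv.
  apply pi_angle_frame_norm with (v t) (u t * Derive v t);
    [now apply velocity_R2_px | now apply velocity_R2_py
    | apply velocity_meridian_px | apply velocity_meridian_py].
Qed.

(** * Loxodromes *)

(** Here [u' = - cosh phi < 0] and [u v' = - e sinh phi = e tanh phi u'], so the criterion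
    [pi_angle_R2] applies. *)
Lemma gamma4_time_like_loxodrome (f : R -> R) (phi e : R) (a b : Rbar) :
  0 <= phi -> e = 1 \/ e = -1 ->
  (forall t, in_interval a b t -> t <> 0) ->
  time_like_loxodrome f phi a b (gamma4 f phi e).
Proof.
  intros Hphi He H0.
  set (u := fun t => - t * cosh phi).
  set (v := fun t => e * tanh phi * ln (Rabs t)).
  assert (Hu : forall t, is_derive u t (- cosh phi)).
  { intros t. unfold u. auto_derive; [exact I | ring]. }
  assert (Hv : forall t, t <> 0 -> is_derive v t (e * tanh phi / t)).
  { intros t Ht. apply (is_derive_scal (fun s => ln (Rabs s)) t (e * tanh phi) (/ t)).
    now apply is_derive_ln_Rabs. }
  assert (Hang : forall t, in_interval a b t ->
            pi_angle (velocity (gamma4 f phi e) t)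
                     (velocity (meridian f (v t)) (u t)) phi).
  { intros t Ht. specialize (H0 t Ht).
    apply (pi_angle_R2 f u v t phi); [eexists; apply Hu | eexists; now apply Hv |].
    rewrite (is_derive_unique _ _ _ (Hu t)), (is_derive_unique _ _ _ (Hv t H0)).
    pose proof (cosh_pos phi). repeat split; [exact Hphi | lra |].
    unfold u. destruct He as [-> | ->]; field; exact H0. }
  split.
  - intros t Ht. now apply (Hang t).
  - exists u, v. split; [| split].
    + intros n t _. apply ex_derive_n_scal_r, ex_derive_n_opp.
      (* The identity is written as a power so that the power rule for [ex_derive_n] applies. *)
      apply ex_derive_n_ext with (fun s => s ^ 1); [intros; ring |].
      apply ex_derive_n_pow.
    + intros n t Ht. apply ex_derive_n_scal_l, ex_derive_n_ln_Rabs. now apply H0.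
    + intros t Ht. split; [reflexivity | now apply Hang].
Qed.

Lemma time_like_loxodrome_gamma4 (f : R -> R) (phi : R) (a b : Rbar)
    (c : R -> point) :
  0 <= phi -> time_like_loxodrome f phi a b c ->
  exists (e v0 : R) (tau : R -> R),
    (e = 1 \/ e = -1) /\
    smooth_on a b tau /\
    forall s, in_interval a b s ->
      (0 < phi -> tau s <> 0) /\
      Derive tau s = pi_norm (velocity c s) /\
      c s = hyp_rot v0 (gamma4 f phi e (tau s)).
Proof.
  intros Hphi [_ (u & v & Hu & Hv & Hc)].
  pose proof (cosh_pos phi) as Hcosh.
  assert (Hu1 : forall t, in_interval a b t -> ex_derive u t)
    by (intros; now apply (smooth_on_ex_derive a b)).
  assert (Hv1 : forall t, in_interval a b t -> ex_derive v t)
    by (intros; now apply (smooth_on_ex_derive a b)).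
  assert (Hu2 : forall t, in_interval a b t -> ex_derive (Derive u) t)
    by (intros; now apply (smooth_on_ex_derive_2 a b)).
  assert (Hv2 : forall t, in_interval a b t -> ex_derive (Derive v) t)
    by (intros; now apply (smooth_on_ex_derive_2 a b)).
  assert (Hvel : forall t, in_interval a b t ->
            velocity c t = velocity (fun s => R2 f (u s) (v s)) t).
  { intros t Ht. apply velocity_ext_loc.
    apply filter_imp with (2 := in_interval_locally a b t Ht).
    intros s Hs. now apply Hc. }
  assert (Hang : forall t, in_interval a b t ->
            pi_angle (velocity (fun s => R2 f (u s) (v s)) t)
                     (velocity (meridian f (v t)) (u t)) phi).
  { intros t Ht. rewrite <- Hvel by exact Ht. now apply Hc. }
  assert (Hdu : forall t, in_interval a b t -> Derive u t < 0).
  { intros t Ht. apply (pi_angle_R2 f u v t phi); auto. }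
  (* Dividing by [u' < 0] turns the angle condition into a quotient whose square is the constant
     [tanh phi ^ 2]. *)
  destruct (constant_sign_of_sqr a b (fun t => u t * Derive v t / Derive u t) (tanh phi))
    as (e & He & Heq).
  { intros t Ht. specialize (Hdu t Ht).
    apply (ex_derive_div (fun s => u s * Derive v s)); [| now apply Hu2 | lra].
    apply (ex_derive_mult u (Derive v)); auto. }
  { intros t Ht. specialize (Hdu t Ht).
    assert (Hw : (u t * Derive v t) ^ 2 = (tanh phi * Derive u t) ^ 2)
      by (apply (pi_angle_R2 f u v t phi); auto).
    unfold Rdiv. rewrite Rpow_mult_distr, Hw. field. lra. }
  assert (Huv : forall t, in_interval a b t ->
            u t * Derive v t = e * tanh phi * Derive u t).
  { intros t Ht. specialize (Hdu t Ht). rewrite <- (Heq t Ht). field. lra. }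
  (* At a zero of [u], [Huv] would give [tanh phi * u' = 0]. For [phi = 0] there is no
     contradiction: a meridian may cross [u = 0]. *)
  assert (Hu0 : 0 < phi -> forall t, in_interval a b t -> u t <> 0).
  { intros Hpos t Ht Hz. pose proof (tanh_pos phi Hpos) as Htanh.
    specialize (Huv t Ht). specialize (Hdu t Ht). rewrite Hz in Huv.
    destruct He as [-> | ->]; nra. }
  (* This solves [u = - tau cosh phi], matching the first surface parameter of [gamma4]. *)
  set (tau := fun t => - / cosh phi * u t).
  assert (Htau : forall t, - tau t * cosh phi = u t).
  { intros t. unfold tau. field. lra. }
  assert (Htau0 : 0 < phi -> forall t, in_interval a b t -> tau t <> 0).
  { intros Hpos t Ht Hz. apply (Hu0 Hpos t Ht). rewrite <- Htau, Hz. ring. }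
  destruct (constant_of_derive_0 a b (fun t => v t - e * tanh phi * ln (Rabs (tau t))))
    as [v0 Hv0].
  { intros t Ht. destruct Hphi as [Hpos | <-].
    (* For [phi > 0], [tau' / tau = u' / u], so [e tanh phi ln |tau|] has derivative
       [e tanh phi u' / u = v']. *)
    - specialize (Htau0 Hpos t Ht). specialize (Hu0 Hpos t Ht).
      assert (Hdtau : is_derive tau t (- / cosh phi * Derive u t)).
      { apply (is_derive_scal u). now apply Derive_correct, Hu1. }
      pose proof (is_derive_comp _ _ _ _ _ (is_derive_ln_Rabs _ Htau0) Hdtau) as Hln.
      pose proof (is_derive_minus _ _ _ _ _ (Derive_correct _ _ (Hv1 t Ht))
                    (is_derive_scal _ _ (e * tanh phi) _ Hln)) as H.
      replace 0 with (minus (Derive v t)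
        (e * tanh phi * scal (- / cosh phi * Derive u t) (/ tau t))); [exact H |].
      replace (Derive v t) with (e * tanh phi * Derive u t / u t)
        by (rewrite <- (Huv t Ht); now field).
      unfold minus, plus, opp, scal, tau; simpl; unfold mult; simpl.
      field. split; [lra | exact Hu0].
    (* For [phi = 0] the factor [tanh 0] kills the logarithmic term, whatever value [ln] takes at 0,
       and [u v' = 0] with [u' < 0] gives [v' = 0]. *)
    - assert (Ht0 : tanh 0 = 0) by (unfold tanh; rewrite sinh_0; field; lra).
      apply is_derive_ext with v.
      { intros s. change (v s = v s - e * tanh 0 * ln (Rabs (tau s))).
        rewrite Ht0. ring. }
      replace 0 with (Derive v t); [now apply Derive_correct, Hv1 |].
      apply derive_0_of_mult_derive_0 with a b u; try assumption.
      + intros s Hs. rewrite (Huv s Hs), Ht0. ring.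
      + apply Rlt_not_eq, Hdu, Ht. }
  exists e, v0, tau. split; [exact He |]. split.
  - intros n t Ht. apply ex_derive_n_scal_l. now apply Hu.
  - intros t Ht. split; [| split].
    + intros Hpos. now apply Htau0.
    + rewrite Hvel by exact Ht.
      rewrite (pi_norm_velocity_R2 f u v t phi); auto.
      unfold tau. rewrite Derive_scal. field. lra.
    + destruct (Hc t Ht) as [-> _].
      assert (Hvt : v t = e * tanh phi * ln (Rabs (tau t)) + v0)
        by (rewrite <- (Hv0 t Ht); ring).
      (* By the addition formulas, adding [v0] to the second surface parameter is the hyperbolic
         rotation by [v0]. *)
      unfold R2, hyp_rot, gamma4; simpl. rewrite Htau, Hvt, sinh_plus, cosh_plus.
      f_equal; ring.
Qed.

(* The curves gamma4 are time-like loxodromes; conversely every time-like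
   loxodrome is, up to a hyperbolic rotation (integration constant of v), a curve
   gamma4 traversed with an arc-length parameter tau. *)
Theorem theorem3p4 (f : R -> R) (hf : smooth f) (phi : R) (hphi : 0 <= phi) :
  (forall (e : R) (a b : Rbar),
      e = 1 \/ e = -1 ->
      (forall t, in_interval a b t -> t <> 0) ->
      time_like_loxodrome f phi a b (gamma4 f phi e))
  /\
  (forall (a b : Rbar) (c : R -> point),
      time_like_loxodrome f phi a b c ->
      exists (e v0 : R) (tau : R -> R),
        (e = 1 \/ e = -1) /\
        smooth_on a b tau /\
        forall s, in_interval a b s ->
          (0 < phi -> tau s <> 0) /\
          Derive tau s = pi_norm (velocity c s) /\
          c s = hyp_rot v0 (gamma4 f phi e (tau s))).
Proof.
  split.
  - intros e a b He H0. now apply gamma4_time_like_loxodrome.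
  - intros a b c Hc. now apply time_like_loxodrome_gamma4.
Qed.
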